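(* $$\sum_{n\ge0}|\Pi_n(14/23)|\,z^n=G\!\left(\frac{z}{1-z}\right)\frac{1}{1-z}+\frac{1}{1-z},\qquad\text{where}\qquad G(z)=\frac{z-2z^2(1+z)-z\sqrt{1-4z^2}}{-2+2z(1+z)^2}.$$
   Context: The standardization of a set partition of a finite set $S\subset\mathbb{Z}_{>0}$ replaces the $i$-th smallest element of $S$ by $i$. A set partition $\pi$ of $[n]$ contains $\tau\vdash[k]$ if for some $S\subseteq[n]$ the standardization of the restriction of $\pi$ to $S$ is $\tau$; otherwise it avoids $\tau$. $\Pi_n(\tau)$ is the set of partitions of $[n]$ avoiding $\tau$, with $|\Pi_0(\tau)|=1$ (the empty partition). $14/23$ is the partition of $[4]$ with blocks $\{1,4\},\{2,3\}$. Here $G(z)$ is the generating function $\sum_{n\ge2}|\Pi_n^*(14/23)|z^n$ of $14/23$-avoiding partitions of $[n]$ without singleton blocks. *)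

(* Defs.v *)
From HB Require Import structures.
From mathcomp Require Import all_boot all_order all_algebra.
From mathcomp Require Import boolp.

Set Implicit Arguments.
Unset Strict Implicit.
Unset Printing Implicit Defensive.

Import GRing.Theory.

(* Set partitions of [n].  The ordinal i : 'I_n stands for the element i + 1
   of [n] = {1, ..., n}; a set partition of [n] is a P : {set {set 'I_n}} with
   partition P [set: 'I_n]. *)

(* The block of [n] whose 1-based labels are listed in s. *)
Definition blk (n : nat) (s : seq nat) : {set 'I_n} := [set i : 'I_n | i.+1 \in s].

Definition p14_23 : {set {set 'I_4}} :=
  [set blk 4 [:: 1; 4]; blk 4 [:: 2; 3]].

Definition restrict (n : nat) (P : {set {set 'I_n}}) (S : {set 'I_n}) :
    {set {set 'I_n}} :=
  [set B :&: S | B in P] :\ set0.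

(* Number of elements of S below x: if x is the i-th smallest element of S
   (i >= 1), this is i - 1, the ordinal standing for the label i. *)
Definition rank_in (n : nat) (S : {set 'I_n}) (x : 'I_n) : nat :=
  #|[set y in S | y < x]|.

(* Meaningful for Q a set partition of S and k = #|S|. *)
Definition standardize (n k : nat) (S : {set 'I_n}) (Q : {set {set 'I_n}}) :
    {set {set 'I_k}} :=
  [set [set i : 'I_k | [exists x in B, rank_in S x == i]] | B : {set 'I_n} in Q].

Definition contains (n k : nat) (P : {set {set 'I_n}})
    (tau : {set {set 'I_k}}) : bool :=
  [exists S : {set 'I_n},
    (#|S| == k) && (standardize k S (restrict P S) == tau)].

Definition avoiders (n k : nat) (tau : {set {set 'I_k}}) :
    {set {set {set 'I_n}}} :=
  [set P | partition P [set: 'I_n] && ~~ contains P tau].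

Definition avoiders_nosingl (n k : nat) (tau : {set {set 'I_k}}) :
    {set {set {set 'I_n}}} :=
  [set P in avoiders n tau | [forall B : {set 'I_n} in P, #|B| != 1]].

Local Open Scope ring_scope.

Record fps (F : fieldType) := FPS { fps_coef :> nat -> F }.

HB.instance Definition _ (F : fieldType) := gen_eqMixin (fps F).
HB.instance Definition _ (F : fieldType) := gen_choiceMixin (fps F).

Lemma fpsP (F : fieldType) (f g : fps F) : (forall n, f n = g n) -> f = g.
Proof. by case: f g => f [g] /= fg; congr FPS; apply/funext. Qed.

Section FpsRing.
Variable F : fieldType.
Implicit Types f g h : fps F.

Definition fps_const (c : F) : fps F := FPS (fun n => if n == 0%N then c else 0).
Definition fps_add f g : fps F := FPS (fun n => f n + g n).
Definition fps_opp f : fps F := FPS (fun n => - f n).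
Definition fps_mul f g : fps F :=
  FPS (fun n => \sum_(i < n.+1) f i * g (n - i)%N).

Fact fps_addA : associative fps_add.
Proof. by move=> f g h; apply: fpsP => n /=; rewrite addrA. Qed.
Fact fps_addC : commutative fps_add.
Proof. by move=> f g; apply: fpsP => n /=; rewrite addrC. Qed.
Fact fps_add0 : left_id (fps_const 0) fps_add.
Proof. by move=> f; apply: fpsP => n /=; rewrite if_same add0r. Qed.
Fact fps_addN : left_inverse (fps_const 0) fps_opp fps_add.
Proof. by move=> f; apply: fpsP => n /=; rewrite if_same addNr. Qed.

HB.instance Definition _ := GRing.isZmodule.Build (fps F)
  fps_addA fps_addC fps_add0 fps_addN.

Definition fps_trunc (N : nat) f : {poly F} := \poly_(i < N.+1) f i.

Lemma fps_mul_trunc N f g n : (n <= N)%N ->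
  fps_mul f g n = (fps_trunc N f * fps_trunc N g)`_n.
Proof.
move=> nN; rewrite coefM; apply: eq_bigr => -[i /= ilt] _.
have iN : (i < N.+1)%N by rewrite (leq_trans ilt).
by rewrite !coef_poly iN ltnS (leq_trans (leq_subr _ _) nN).
Qed.

Fact fps_mulA : associative fps_mul.
Proof.
move=> f g h; apply: fpsP => n.
transitivity ((fps_trunc n f * (fps_trunc n g * fps_trunc n h))`_n).
  rewrite coefM; apply: eq_bigr => -[i /= ilt] _.
  by rewrite coef_poly ilt -fps_mul_trunc ?leq_subr.
rewrite mulrA coefM; apply: eq_bigr => -[i /= ilt] _.
by rewrite -fps_mul_trunc // coef_poly ltnS leq_subr.
Qed.

Fact fps_mulC : commutative fps_mul.
Proof.
by move=> f g; apply: fpsP => n; rewrite !(@fps_mul_trunc n) // mulrC.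
Qed.

Fact fps_mul1 : left_id (fps_const 1) fps_mul.
Proof.
move=> f; apply: fpsP => n /=.
rewrite big_ord_recl /= mul1r subn0 big1 ?addr0 // => i _.
by rewrite mul0r.
Qed.

Fact fps_mulDl : left_distributive fps_mul fps_add.
Proof.
move=> f g h; apply: fpsP => n /=; rewrite -big_split.
by apply: eq_bigr => i _; rewrite /= mulrDl.
Qed.

Fact fps_nonzero : fps_const 1 != 0.
Proof. by apply/eqP => /(congr1 (fun h : fps F => h 0%N))/eqP /=; rewrite oner_eq0. Qed.

HB.instance Definition _ := GRing.Zmodule_isComNzRing.Build (fps F)
  fps_mulA fps_mulC fps_mul1 fps_mulDl fps_nonzero.

Lemma fps_coefD f g n : (f + g) n = f n + g n. Proof. by []. Qed.
Lemma fps_coefN f n : (- f) n = - f n. Proof. by []. Qed.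
Lemma fps_coefM f g n : (f * g) n = \sum_(i < n.+1) f i * g (n - i)%N.
Proof. by []. Qed.
Lemma fps_coef0 n : (0 : fps F) n = 0. Proof. by rewrite /= if_same. Qed.
Lemma fps_coef1 n : (1 : fps F) n = (n == 0%N)%:R.
Proof. by case: n. Qed.

(* Series defined by well-founded recursion: step receives the list of the
   first n coefficients and returns the coefficient of index n. *)
Fixpoint fps_prefix (step : seq F -> F) (n : nat) : seq F :=
  if n is m.+1 then
    let s := fps_prefix step m in rcons s (step s)
  else [::].
Definition fps_rec (step : seq F -> F) : fps F :=
  FPS (fun n => step (fps_prefix step n)).

Lemma fps_recE step n :
  fps_rec step n = step (mkseq (fps_rec step) n).
Proof.
suff E m : fps_prefix step m = mkseq (fps_rec step) m by rewrite -E.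
by elim: m => // m IHm; rewrite mkseqS -IHm.
Qed.

(* The identity \sum_(i <= n) f (n - i) * g i = (n == 0)%:R solved for g n. *)
Definition fps_inv_step f (s : seq F) : F :=
  (f 0%N)^-1 *
    ((size s == 0%N)%:R - \sum_(i < size s) f (size s - i)%N * s`_i).

Definition fps_unit : pred (fps F) := fun f => f 0%N != 0.
Definition fps_inv f : fps F :=
  if fps_unit f then fps_rec (fps_inv_step f) else f.

Fact fps_mulV : {in fps_unit, left_inverse 1 fps_inv *%R}.
Proof.
move=> f uf; rewrite /fps_inv ifT //; apply: fpsP => n.
have := fps_recE (fps_inv_step f) n; move: (fps_rec _) => g gE.
rewrite fps_coefM fps_coef1 big_ord_recr /= gE /fps_inv_step size_mkseq subnn.
rewrite [X in _ + X]mulrC mulrA mulfV // mul1r addrC.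
set a := (X in _ - X + _); set b := (X in _ - _ + X).
suff -> : b = a by rewrite subrK.
by apply: eq_bigr => i _; rewrite nth_mkseq // mulrC.
Qed.

Fact fps_unitPl f g : g * f = 1 -> fps_unit f.
Proof.
move/(congr1 (fun h : fps F => h 0%N)); rewrite fps_coefM big_ord1 subn0 fps_coef1.
by move=> gf; apply: contra_eq_neq gf => ->; rewrite mulr0 eq_sym oner_eq0.
Qed.

Fact fps_inv_out : {in [predC fps_unit], fps_inv =1 id}.
Proof. by move=> f /negbTE uf; rewrite /fps_inv ifF. Qed.

HB.instance Definition _ := GRing.ComNzRing_hasMulInverse.Build (fps F)
  fps_mulV fps_unitPl fps_inv_out.

Lemma fps_unitE f : (f \is a GRing.unit) = (f 0%N != 0). Proof. by []. Qed.

Definition fpsX : fps F := FPS (fun n => (n == 1%N)%:R).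

(* f(g(z)), for g without constant term: then g ^+ k has no term of degree
   less than k, and the sum below is the whole coefficient. *)
Definition fps_comp f g : fps F :=
  FPS (fun n => \sum_(k < n.+1) f k * (g ^+ k) n).

(* For f with constant term 1 and 2 != 0 in F: the square root of f with
   constant term 1 (see fps_sqrt_coef0 and fps_sqr_sqrt). *)
Definition fps_sqrt_step f (s : seq F) : F :=
  if size s is n.+1 then
    (f n.+1 - \sum_(1 <= i < n.+1) s`_i * s`_(n.+1 - i)) / 2
  else 1.
Definition fps_sqrt f : fps F := fps_rec (fps_sqrt_step f).

Lemma fps_sqrt_coef0 f : fps_sqrt f 0%N = 1. Proof. by []. Qed.

Lemma fps_sqr_sqrt f : (2 : F) != 0 -> f 0%N = 1 -> fps_sqrt f ^+ 2 = f.
Proof.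
move=> two_n0 f0; apply: fpsP => -[|n].
  by rewrite expr2 fps_coefM big_ord1 fps_sqrt_coef0 mulr1.
have := fps_recE (fps_sqrt_step f) n.+1; have := fps_sqrt_coef0 f.
rewrite -/(fps_sqrt f); move: (fps_sqrt f) => g g0 gE.
rewrite expr2 fps_coefM big_ord_recl big_ord_recr /= /bump /= add1n.
rewrite subn0 subnn g0 mul1r mulr1 addrCA -mulr2n -mulr_natr.
rewrite gE {1}/fps_sqrt_step size_mkseq.
rewrite divfK // big_add1 big_mkord addrC.
set a := (X in _ - X + _); set b := (X in _ - _ + X).
suff -> : b = a by rewrite subrK.
apply: eq_bigr => i _.
by rewrite !nth_mkseq ?ltnS ?subSS ?leq_subr // ltnW.
Qed.

End FpsRing.

Definition gf_14_23 : fps rat :=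
  FPS (fun n => #|avoiders n p14_23|%:R).

Definition gf_nosingl_14_23 : fps rat :=
  FPS (fun n => if (2 <= n)%N then #|avoiders_nosingl n p14_23|%:R else 0).

(* Main.v *)
Require Import Defs.
From mathcomp Require Import all_boot all_order all_algebra.
From mathcomp Require Import zify ring.
Import GRing.Theory.

Set Implicit Arguments.
Unset Strict Implicit.
Unset Printing Implicit Defensive.

(* Record for each element whether it is the minimum and whether it is the
   maximum of its block.  In a partition avoiding 14/23 the blocks of size at
   least 2 open and close in the same order, and a third element of such a
   block can only occur while no other such block is open.  Hence the partition
   is recovered from the word by matching the i-th opener with the i-th closer,
   and the words are the Dyck words with extra letters inserted: interior
   elements at height 1, singletons anywhere.  Singletons do not affect the
   height, which gives the substitution z/(1-z) as a binomial transform.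
   Without singletons, let F_h be the series of the words from height h to 0.
   Above height 1 the recurrence of the F_h is that of Dyck paths, so that
   F_(h+1) = u F_h for h >= 1, where u = z (1 + u^2), and then
   G (1 - z - z^2 - z u) = z^2; multiplying by 1 + z - u rationalizes the
   denominator. *)

(** * Words over the four letters and the height condition *)

(* [(is the minimum of its block, is the maximum of its block)] *)
Definition letter := (bool * bool)%type.
Definition opener (x : letter) := x.1 && ~~ x.2.
Definition closer (x : letter) := ~~ x.1 && x.2.

(* [h] counts the blocks of size at least 2 that are currently open. *)
Fixpoint valid (h : nat) (w : seq letter) : bool :=
  match w with
  | [::] => h == 0
  | (true, false) :: w' => valid h.+1 w'
  | (false, true) :: w' => (0 < h) && valid h.-1 w'
  | (false, false) :: w' => (h == 1) && valid h w'
  | (true, true) :: w' => valid h w'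
  end.

(* The default letter is a singleton, hence neither an opener nor a closer. *)
Definition before (a : pred letter) (w : seq letter) (i : nat) : nat :=
  \sum_(j < i) a (nth (true, true) w j).

Lemma beforeS (a : pred letter) w i : before a w i.+1 = before a w i + a (nth (true, true) w i).
Proof. by rewrite /before big_ord_recr. Qed.

Lemma before_cons (a : pred letter) x w i : before a (x :: w) i.+1 = a x + before a w i.
Proof. by rewrite /before big_ord_recl. Qed.

Lemma before0 a w : before a w 0 = 0.
Proof. by rewrite /before big_ord0. Qed.

Lemma leq_before a w i j : i <= j -> before a w i <= before a w j.
Proof.
move=> /subnK <-; elim: (j - i) => // d /leq_trans -> //.
by rewrite addSn beforeS leq_addr.
Qed.

Lemma ltn_before (a : pred letter) w i j :
  a (nth (true, true) w i) -> i < j -> before a w i < before a w j.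
Proof. by move=> ai /(leq_before a w); rewrite beforeS ai addn1. Qed.

(** The count rises by at most one per position, so it passes from [k] to [k.+1] at some letter
    satisfying [a]. *)
Lemma before_witness (a : pred letter) w j k : k < before a w j ->
  exists i, [/\ i < j, a (nth (true, true) w i) & before a w i = k].
Proof.
elim: j => [|j IH]; first by rewrite before0.
rewrite beforeS; have [/IH [i [ij ai <-]] _|kj] := ltnP k (before a w j).
  by exists i; split=> //; apply: leqW.
case aj: (a _) => kj1; last by lia.
by exists j; split=> //; lia.
Qed.

(** The height at [i] is [h] plus the openers minus the closers before [i]. The recursive condition
    becomes relations between counts, kept free of subtraction, which truncates on [nat]. *)
Lemma validP h w : valid h w <->
  (forall i, i < size w -> ~~ (nth (true, true) w i).1 ->
     before closer w i < h + before opener w i /\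
     (~~ (nth (true, true) w i).2 ->
        h + before opener w i = (before closer w i).+1)) /\
  h + before opener w (size w) = before closer w (size w).
Proof.
elim: w h => [|x w IH] h.
  by rewrite /= !before0; split=> [/eqP -> //|[_ E]]; apply/eqP; lia.
split.
  move=> V.
  (* [h'] is the height after the first letter. *)
  have [h' [V' E Hx]] : exists h', [/\ valid h' w,
      h + opener x = h' + closer x & ~~ x.1 -> 0 < h /\ (~~ x.2 -> h = 1)].
    case: x V => [[] []] /=.
    - by exists h; split; rewrite ?addn0.
    - by exists h.+1; split=> //; rewrite /opener /closer /=; lia.
    - by case/andP=> h0 ?; exists h.-1; split=> //; rewrite /opener /closer /=; lia.
    - by case/andP=> /eqP h1 ?; exists h; split=> //; lia.
  have [H1 H2] := (IH h').1 V'; split; last by rewrite /= !before_cons; lia.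
  move=> [_ /Hx|i]; rewrite ?before0 /=; first by case=> ? Hm; split=> [|/Hm]; lia.
  rewrite ltnS !before_cons => /H1 {}H1 /H1 [? Hm]; split; first by lia.
  by move/Hm; lia.
rewrite [size _]/= !before_cons => -[H1 H2].
have H0 : ~~ x.1 -> 0 < h /\ (~~ x.2 -> h = 1).
  by move=> /(H1 0 isT) /=; rewrite !before0 addn0.
have Hv h' : h + opener x = h' + closer x -> valid h' w.
  move=> E; apply/IH; split=> [i iw Hi|]; last by lia.
  have /= := H1 i.+1 iw Hi; rewrite !before_cons => -[? Hm].
  by split=> [|/Hm]; lia.
case: x H0 Hv {H1 H2} => [[] []] /= H0 Hv.
- exact: Hv.
- by apply: Hv; rewrite /opener /closer /=; lia.
- by have [//|-> _] := H0; apply: Hv; rewrite /opener /closer /=; lia.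
- by have [//|_ ->] := H0; rewrite //= ; apply: Hv; rewrite /opener /closer /=; lia.
Qed.

(** * Enumeration of the valid words *)

(** The flag [s] allows singleton letters, so that one function counts both all avoiders and those
    without singleton blocks. *)
Fixpoint paths (s : bool) (n h : nat) : seq (seq letter) :=
  if n is m.+1 then
    [seq (true, false) :: w | w <- paths s m h.+1] ++
    (if h is h'.+1 then [seq (false, true) :: w | w <- paths s m h'] else [::]) ++
    (if h == 1 then [seq (false, false) :: w | w <- paths s m h] else [::]) ++
    (if s then [seq (true, true) :: w | w <- paths s m h] else [::])
  else if h == 0 then [:: [::]] else [::].

Lemma mem_map_cons (T : eqType) (x y : T) w (l : seq (seq T)) :
  (x :: w \in [seq y :: v | v <- l]) = (x == y) && (w \in l).
Proof.
apply/mapP/andP => [[v vl [-> ->]]|[/eqP -> wl]]; first by rewrite eqxx.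
by exists w.
Qed.

Lemma mem_paths s n h w :
  (w \in paths s n h) = [&& size w == n, valid h w & s || ((true, true) \notin w)].
Proof.
elim: n h w => [|n IH] h [|x w] /=.
- by case: eqP; rewrite ?in_nil // orbT.
- by case: eqP.
- rewrite !mem_cat; do !case: ifP => _; case: h => [|h];
    by rewrite ?in_nil; do ?[case: mapP => [[]//|_]].
rewrite eqSS !mem_cat !mem_map_cons !(fun_if (fun l => x :: w \in l)) !mem_map_cons.
rewrite !in_nil !IH inE.
case: h => [|h]; rewrite ?mem_map_cons ?in_nil ?IH; case: x => [[] []] /=;
  rewrite ?if_same ?andbF ?orbF ?andbT //=.
- by case: (s); rewrite ?andbF ?andbT.
- by case: (s); rewrite ?andbF ?andbT.
- by case: (h.+1 == 1); rewrite ?andbF.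
Qed.

Lemma paths_uniq s n h : uniq (paths s n h).
Proof.
have injc (x : letter) : injective (cons x) by move=> ? ? [].
have dis (x y : letter) (l l' : seq (seq letter)) : x != y ->
    ~~ has (mem [seq x :: v | v <- l]) [seq y :: v | v <- l'].
  by move=> xy; apply/hasP => -[_ /mapP [v _ ->]] /=;
     rewrite mem_map_cons eq_sym (negbTE xy).
elim: n h => [|n IH] h /=; first by case: ifP.
by case: s IH => IH; case: h => [|[|h]] //=;
  rewrite ?cat_uniq ?has_cat ?(map_inj_uniq (injc _)) ?negb_or ?dis //= ?IH.
Qed.

(** * Labellings and words *)

(** Blocks are the fibres of a map [k], so that the same notion serves for [pblock P] and for the
    labels read off a word. *)
Definition avoids_nesting (n : nat) (T : eqType) (k : 'I_n -> T) : Prop :=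
  forall a b c d : 'I_n, a < b -> b < c -> c < d ->
    k a = k d -> k b = k c -> k a = k b.

Definition class_letter (n : nat) (T : eqType) (k : 'I_n -> T) (i : 'I_n) : letter :=
  ([forall j, (k j == k i) ==> (i <= j)], [forall j, (k j == k i) ==> (j <= i)]).

Definition word_of (n : nat) (T : eqType) (k : 'I_n -> T) : seq letter :=
  [seq class_letter k i | i <- enum 'I_n].

(* Blocks are numbered by their openers; as they close in the same order, a
   non-opener lies in the block whose number is that of the closers before it.
   The boolean keeps the labels of singletons apart. *)
Definition label (w : seq letter) (i : nat) : bool * nat :=
  let x := nth (true, true) w i in
  if x == (true, true) then (true, i)
  else (false, if x.1 then before opener w i else before closer w i).

Lemma nth_word_of n (T : eqType) (k : 'I_n -> T) (i : 'I_n) :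
  nth (true, true) (word_of k) i = class_letter k i.
Proof. by rewrite (nth_map i) ?size_enum_ord // nth_ord_enum. Qed.

Lemma size_word_of n (T : eqType) (k : 'I_n -> T) : size (word_of k) = n.
Proof. by rewrite size_map size_enum_ord. Qed.

Lemma before_word_of (a : pred letter) n (T : eqType) (k : 'I_n -> T) m : m <= n ->
  before a (word_of k) m = #|[set j : 'I_n | a (class_letter k j) && (j < m)]|.
Proof.
move=> mn; rewrite /before (big_ord_widen _ (fun j => nat_of_bool (a (nth _ _ j))) mn).
rewrite -sum1dep_card [RHS]big_mkcond [LHS]big_mkcond /=.
apply: eq_bigr => j _.
by rewrite nth_word_of; case: (a _); case: (j < m).
Qed.

(** * From an avoider to its word *)

Section WordOfAvoider.
Variables (n : nat) (T : eqType) (k : 'I_n -> T).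
Hypothesis k_avoids : avoids_nesting k.

Let mn i : 'I_n := [arg min_(j < i | k j == k i) val j].
Let mx i : 'I_n := [arg max_(j > i | k j == k i) val j].
Let L := class_letter k.

Let mnP i : k (mn i) = k i /\ forall j, k j = k i -> mn i <= j.
Proof.
rewrite /mn; case: arg_minnP => // j /eqP -> H; split=> // j' /eqP; exact: H.
Qed.

Let mxP i : k (mx i) = k i /\ forall j, k j = k i -> j <= mx i.
Proof.
rewrite /mx; case: arg_maxnP => // j /eqP -> H; split=> // j' /eqP; exact: H.
Qed.

Let L1 i : (L i).1 = (mn i == i).
Proof.
have [kn Hn] := mnP i; apply/forallP/eqP => [H|<- j].
  by apply/val_inj/eqP; rewrite eqn_leq Hn //=; have := H (mn i); rewrite kn eqxx.
by apply/implyP => /eqP; rewrite kn; apply: Hn.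
Qed.

Let L2 i : (L i).2 = (mx i == i).
Proof.
have [kn Hn] := mxP i; apply/forallP/eqP => [H|<- j].
  by apply/val_inj/eqP; rewrite eqn_leq Hn //= andbT; have := H (mx i); rewrite kn eqxx.
by apply/implyP => /eqP; rewrite kn; apply: Hn.
Qed.

Let mn_eq i j : k i = k j -> mn i = mn j.
Proof.
move=> kij; have [ki Hi] := mnP i; have [kj Hj] := mnP j.
by apply/val_inj/eqP; rewrite eqn_leq Hi ?Hj //; congruence.
Qed.

Let mx_eq i j : k i = k j -> mx i = mx j.
Proof.
move=> kij; have [ki Hi] := mxP i; have [kj Hj] := mxP j.
by apply/val_inj/eqP; rewrite eqn_leq Hi ?Hj //; congruence.
Qed.

Let openerP i : reflect (mn i = i /\ i < mx i) (opener (L i)).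
Proof.
have [kx Hx] := mxP i.
rewrite /opener L1 L2; apply: (iffP andP) => [[/eqP -> ne]|[-> lt]].
  by split=> //; rewrite ltn_neqAle Hx // andbT eq_sym.
by rewrite eqxx; split=> //; rewrite -val_eqE /=; lia.
Qed.

(** [mx] maps openers bijectively onto closers, so each closer can be counted through the opener of
    its block. *)
Let closers_before m : m <= n ->
  before closer (word_of k) m = #|[set j | opener (L j) && (mx j < m)]|.
Proof.
move=> le_m; rewrite before_word_of //.
rewrite -[RHS](@card_in_imset _ _ mx); last first.
  move=> i j; rewrite !inE => /andP [/openerP [Ei _] _] /andP [/openerP [Ej _] _] E.
  rewrite -Ei -Ej; apply: mn_eq; have [ki _] := mxP i; have [kj _] := mxP j; congruence.
apply: eq_card => i; rewrite inE; apply/andP/imsetP.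
  move=> [/andP [Hi1 Hi2] im]; move: Hi1 Hi2; rewrite L1 L2 => ne /eqP Ex.
  have [ki Hi] := mnP i; have Emx : mx (mn i) = i by rewrite (mx_eq ki).
  exists (mn i) => //; rewrite inE Emx im andbT.
  apply/openerP; rewrite Emx (mn_eq ki); split=> //.
  by rewrite ltn_neqAle Hi // andbT.
move=> [j]; rewrite inE => /andP [/openerP [Ej lt] jm ->]; split=> //.
have [kj _] := mxP j.
rewrite /closer L1 L2 (mn_eq kj) (mx_eq kj) Ej eqxx andbT.
by rewrite -val_eqE /=; lia.
Qed.

(* A block opens before that of [i] iff it closes before [i]. *)
Let earlier_blocks i : mn i != i ->
  before closer (word_of k) i = before opener (word_of k) (mn i).
Proof.
move=> ne; rewrite closers_before ?(ltnW (ltn_ord _)) // before_word_of ?(ltnW (ltn_ord _)) //.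
apply: eq_card => j; rewrite !inE; apply: andb_id2l => /openerP [Ej lt].
have [ki Hi] := mnP i; have [kx Hx] := mxP j; have [_ Hn] := mnP j.
have lti : mn i < i by rewrite ltn_neqAle Hi // andbT.
have kne : mn i != j -> k j != k i.
  by apply: contraNneq => E; rewrite -(mn_eq E) Ej.
apply/idP/idP => [xi|ji].
  rewrite ltnNge leq_eqVlt; apply/negP => /orP [/eqP/val_inj E|ij].
    by move: xi; rewrite ltnNge Hx // -ki E.
  (* Here [mn i < j < mx j < i] would be a nesting. *)
  have /eqP [] : k j != k i by apply: kne; rewrite -val_eqE /= ltn_eqF.
  by rewrite -ki (k_avoids ij lt xi ki (esym kx)).
have {}kne : k j <> k i by apply/eqP/kne; rewrite -val_eqE /=; lia.
rewrite ltn_neqAle; apply/andP; split.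
  by apply/eqP => /val_inj E; apply: kne; rewrite -E.
(* Otherwise [j < mn i < i < mx j] would be a nesting. *)
rewrite leqNgt; apply/negP => ix; apply: kne; rewrite -ki.
exact: (k_avoids ji lti ix (esym kx) ki).
Qed.

Let label_word_of (i : 'I_n) : label (word_of k) i =
  if L i == (true, true) then (true, val i)
  else (false, before opener (word_of k) (mn i)).
Proof.
rewrite /label nth_word_of -/L; case: ifP => // _.
by rewrite L1; case: eqP => [->//|/eqP/earlier_blocks ->].
Qed.

(** Outside singletons, the label counts the openers before the block minimum. That minimum is
    itself an opener, where the count strictly increases, so the label determines the block. *)
Lemma label_word_ofE (i j : 'I_n) : (label (word_of k) i == label (word_of k) j) = (k i == k j).
Proof.
have single i' : L i' = (true, true) -> forall j', k j' = k i' -> j' = i'.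
  move=> E; have := L1 i'; have := L2 i'; rewrite E => /esym /eqP Ex /esym /eqP En j' kj.
  have [_ /(_ j' kj)] := mnP i'; have [_ /(_ j' kj)] := mxP i'; rewrite Ex En => ? ?.
  by apply/val_inj/eqP; rewrite eqn_leq; apply/andP.
have nonsingle i' : L i' != (true, true) -> opener (L (mn i')).
  move=> ne; have [ki Hi] := mnP i'; have [kx Hx] := mxP i'.
  apply/openerP; rewrite (mn_eq ki) (mx_eq ki); split=> //.
  have : ~~ ((mn i' == i') && (mx i' == i')).
    by apply: contra ne => /andP [E1 E2]; rewrite [L i']surjective_pairing L1 L2 E1 E2.
  by have := Hi i' erefl; have := Hx i' erefl; rewrite -!val_eqE /=; lia.
rewrite !label_word_of.
case: (L i =P (true, true)) => [Ei|/eqP Ei]; case: (L j =P (true, true)) => [Ej|/eqP Ej].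
- rewrite xpair_eqE eqxx /= val_eqE; apply/eqP/eqP => [-> //|]; exact: single.
- rewrite xpair_eqE /=; apply/esym/eqP => kij; move: Ej.
  by rewrite (single _ Ei j) // Ei eqxx.
- rewrite xpair_eqE /=; apply/esym/eqP => kij; move: Ei.
  by rewrite (single _ Ej i) // Ej eqxx.
rewrite xpair_eqE eqxx /=; apply/eqP/eqP => [E|/mn_eq -> //].
have [ki _] := mnP i; have [kj _] := mnP j; rewrite -ki -kj; congr k; apply/val_inj => /=.
have oi : opener (nth (true, true) (word_of k) (mn i)) by rewrite nth_word_of nonsingle.
have oj : opener (nth (true, true) (word_of k) (mn j)) by rewrite nth_word_of nonsingle.
by case: (ltngtP (mn i) (mn j)) => // [/(ltn_before oi)|/(ltn_before oj)]; rewrite E ltnn.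
Qed.

(** At a non-minimum [i] the block opened at [mn i] is still open, so the height is positive; at an
    interior [i] any other open block would create a nesting. *)
Lemma valid_word_of : valid 0 (word_of k).
Proof.
apply/validP; rewrite size_word_of; split; last first.
  rewrite closers_before // before_word_of //; apply: eq_card => j.
  by rewrite !inE !ltn_ord.
move=> i0 lt_i0; pose i := Ordinal lt_i0; rewrite -[i0]/(val i).
rewrite nth_word_of -/L L1 L2 add0n => ne; rewrite (earlier_blocks ne).
have [ki Hi] := mnP i; have [kx Hx] := mxP i.
have lti : mn i < i by rewrite ltn_neqAle Hi // andbT.
have oi : opener (L (mn i)).
  by apply/openerP; rewrite (mn_eq ki) (mx_eq ki); split=> //; apply: leq_trans (Hx i _).
split; first by apply: ltn_before => //; rewrite nth_word_of.
move=> nx; rewrite -addn1.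
have ltx : i < mx i by rewrite ltn_neqAle Hx // andbT eq_sym.
(* The [1] is the contribution of the opener [mn i]; it remains to exclude an opener [j] strictly
   between [mn i] and [i]. *)
have -> : 1 = opener (nth (true, true) (word_of k) (mn i)) by rewrite nth_word_of oi.
rewrite -beforeS !before_word_of ?(ltnW (ltn_ord _)) //.
apply: eq_card => j; rewrite !inE; apply: andb_id2l => /openerP [Ej lt].
apply/idP/idP => [ji|]; last by rewrite ltnS => /leq_ltn_trans; apply.
rewrite ltnS leqNgt; apply/negP => ij; have [kj Hj] := mxP j.
have kne : k i <> k j.
  by move=> E; move: ij; rewrite (mn_eq E) Ej ltnn.
have [xi|ix|/val_inj E] := ltngtP (mx j) i; last by apply: kne; rewrite -E.
  by apply: kne; rewrite -ki (k_avoids ij lt xi ki (esym kj)).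
(* If [mx j < mx i], the pair [j], [mx j] lies inside [mn i], [mx i]; if [mx i < mx j], the pair
   [i], [mx i] lies inside [j], [mx j]. *)
have [xx|xx|/val_inj E] := ltngtP (mx j) (mx i).
- by apply: kne; rewrite -ki (k_avoids ij lt xx (etrans ki (esym kx)) (esym kj)).
- by apply: kne; rewrite (k_avoids ji ltx xx (esym kj) (esym kx)).
- by apply: kne; congruence.
Qed.

End WordOfAvoider.

(** * From a valid word back to an avoider *)

Section AvoiderOfWord.
Variables (n : nat) (w : seq letter).
Hypotheses (w_size : size w = n) (w_valid : valid 0 w).

Let o i := before opener w i.
Let c i := before closer w i.
Let x i := nth (true, true) w i.

Let oS i : o i.+1 = o i + ((x i).1 && ~~ (x i).2).
Proof. exact: beforeS. Qed.

Let cS i : c i.+1 = c i + (~~ (x i).1 && (x i).2).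
Proof. exact: beforeS. Qed.

Let o_gt_c i : i < n -> ~~ (x i).1 -> c i < o i /\ (~~ (x i).2 -> o i = (c i).+1).
Proof. by rewrite -w_size; have [/validP [H _]] := w_valid; apply: H. Qed.

Let o_eq_c : o n = c n.
Proof. by rewrite -w_size; have [/validP [_ H]] := w_valid; apply: H. Qed.

Let c_le_o i : i <= n -> c i <= o i.
Proof.
elim: i => [|i IH] lt; first by rewrite /c /o !before0.
have := IH (ltnW lt); have := o_gt_c lt; rewrite oS cS.
by case: (x i) => [[] []] /=; lia.
Qed.

(* [before opener] increases at the opener and [before closer] at the closer:
   both reduce membership in a block to a value of a monotone function. *)
Let labelP i k : i < n -> label w i = (false, k) <->
  [/\ ~~ ((x i).1 && (x i).2), (x i).2 = false -> o i.+1 = k.+1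
    & (x i).1 = false -> c i = k].
Proof.
move=> lt; have := o_gt_c lt; rewrite /label -/(x i) -/(o i) -/(c i) oS.
case: (x i) => [[] []] /=; rewrite ?xpair_eqE /=.
- by move=> _; split=> // -[].
- by move=> _; split=> [[<-]|[_ H _]]; [split=> //; lia|congr (_, _); have := H erefl; lia].
- by case=> // E _; split=> [[<-]|[_ _ H]]; [split=> //; lia|congr (_, _); exact: H].
case=> // E1 E2; split=> [[<-]|[_ _ H]]; last by congr (_, _); exact: H.
by split=> //; have := E2 isT; lia.
Qed.

(** A maximum at [i] would push [c], and with it [o], above [k] before [j]; a minimum at [j] would
    need [o j = k] although [o] has already reached [k.+1]. *)
Let same_label i j k : i < j -> j < n -> label w i = (false, k) -> label w j = (false, k) ->
  [/\ (x i).2 = false, o i.+1 = k.+1, (x j).1 = false & c j = k].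
Proof.
move=> ij lt_j; have lt_i := ltn_trans ij lt_j.
move=> /(labelP k lt_i) [si oi ci] /(labelP k lt_j) [sj oj cj].
have := c_le_o (ltnW lt_j); have : o i.+1 <= o j by apply: leq_before.
have : c i.+1 <= c j by apply: leq_before.
move: oi ci si oj cj sj; rewrite !oS !cS.
case: (x i) => [[] []]; case: (x j) => [[] []] //= oi ci _ oj cj _;
  try have {}oi := oi erefl; try have {}ci := ci erefl;
  try have {}oj := oj erefl; try have {}cj := cj erefl;
  by first [lia | split; lia].
Qed.

Let label_single i k : label w i = (true, k) -> i = k.
Proof. by rewrite /label; case: ifP => _ []. Qed.

Let label_at (i j : nat) : label w i = label w j -> i != j ->
  exists k, label w i = (false, k) /\ label w j = (false, k).
Proof.
case E: (label w i) => [[] k] Ej ne; last by exists k.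
by move: ne; rewrite (label_single E) (label_single (esym Ej)) eqxx.
Qed.

(** Let [p] and [q] number the outer and the inner pair: [a < b] gives [p <= q] through the openers,
    and [e < d] gives [q <= p] through the closers. *)
Lemma label_avoids : avoids_nesting (fun i : 'I_n => label w i).
Proof.
move=> a b e d ab be ed Ead Ebe.
have ad : a < d := ltn_trans ab (ltn_trans be ed).
have [p [La Ld]] := label_at Ead (negbT (ltn_eqF ad)).
have [q [Lb Le]] := label_at Ebe (negbT (ltn_eqF be)).
have [_ oa _ cd] := same_label ad (ltn_ord d) La Ld.
have [_ ob _ ce] := same_label be (ltn_ord e) Lb Le.
have : o a.+1 <= o b.+1 by apply: leq_before; rewrite ltnS ltnW.
have : c e <= c d by apply/leq_before/ltnW.
by rewrite oa ob cd ce La Lb => ? ?; congr (_, _); lia.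
Qed.

Lemma class_letter_label (i : 'I_n) :
  class_letter (fun i : 'I_n => label w i) i = x i.
Proof.
have lt := ltn_ord i; rewrite [x i]surjective_pairing /class_letter.
case Ei : (label w i) => [s k]; congr (_, _).
  case E: (x i).1; [apply/forallP => j; apply/implyP => /eqP Ej|].
    rewrite leqNgt; apply/negP => ji.
    have [k' [Lj Li]] := label_at (etrans Ej (esym Ei)) (negbT (ltn_eqF ji)).
    by have [_ _] := same_label ji lt Lj Li; rewrite E.
  have sF : s = false.
    by move: Ei; rewrite /label -/(x i); case: eqP => [Ex|_ [] //]; rewrite Ex in E.
  rewrite sF in Ei; have [_ _ /(_ E) ci] := (labelP k lt).1 Ei.
  (* Since [c i = k < o i], some opener before [i] has number [k], so [i] is not the minimum of its
     class. *)
  have [] := o_gt_c lt (negbT E); rewrite ci => /before_witness [j [ji oj Eoj]] _.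
  apply/negP => /forallP /(_ (Ordinal (ltn_trans ji lt))) /=.
  have -> : label w j = (s, k).
    rewrite sF /label; move: oj; rewrite /opener -/(x j) -/(o j).
    by case: (x j) => [[] []] //= _; rewrite -Eoj.
  by rewrite sF eqxx leqNgt ji.
case E: (x i).2; [apply/forallP => j; apply/implyP => /eqP Ej|].
  rewrite leqNgt; apply/negP => ij.
  have [k' [Li Lj]] := label_at (etrans Ei (esym Ej)) (negbT (ltn_eqF ij)).
  by have [] := same_label ij (ltn_ord j) Li Lj; rewrite E.
have sF : s = false.
  by move: Ei; rewrite /label -/(x i); case: eqP => [Ex|_ [] //]; rewrite Ex in E.
rewrite sF in Ei *; have [_ /(_ E) oi _] := (labelP k lt).1 Ei.
(* All openers are matched in the end, so some closer has number [k]; by [same_label] it lies after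
   [i]. *)
have : k < c n by rewrite -o_eq_c -oi; apply: leq_before.
move=> /before_witness [j [jn cj Ecj]].
apply/negP => /forallP /(_ (Ordinal jn)) /=.
have Lj : label w j = (false, k).
  rewrite /label; move: cj; rewrite /closer -/(x j) -/(c j).
  by case: (x j) => [[] []] //= _; rewrite -Ecj.
rewrite Lj eqxx /= leq_eqVlt => /orP [/eqP ji|ji].
  by move: cj; rewrite ji /closer -/(x i) E andbF.
have [F _ _ _] := same_label ji lt Lj Ei.
by move: cj; rewrite /closer -/(x j) F andbF.
Qed.

End AvoiderOfWord.

(** * Containment of 14/23 as a nesting of two blocks *)

Lemma rank_inE n (S : {set 'I_n}) x : rank_in S x = \sum_(y in S) (y < x).
Proof.
rewrite /rank_in -sum1dep_card [RHS]big_mkcond [LHS]big_mkcond /=; apply: eq_bigr => y _.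
by case: (y \in S); case: (y < x).
Qed.

Lemma ltn_of_rank_in n (S : {set 'I_n}) x y : rank_in S x < rank_in S y -> x < y.
Proof.
rewrite ltnNge => H; rewrite ltnNge; apply: contra H => yx.
apply/subset_leq_card/subsetP => z; rewrite !inE => /andP [-> /= zy].
exact: leq_trans zy yx.
Qed.

Section Containment.
Variables (n : nat) (P : {set {set 'I_n}}).
Hypothesis partP : partition P [set: 'I_n].

Let tiP : trivIset P. Proof. by case/and3P: partP. Qed.
Let coverP x : x \in cover P. Proof. by rewrite (cover_partition partP) inE. Qed.

Let nesting_of_contains : contains P p14_23 ->
  exists a b c d : 'I_n, [/\ a < b, b < c & c < d] /\
    [/\ pblock P a = pblock P d, pblock P b = pblock P c & pblock P a <> pblock P b].
Proof.
case/existsP => S /andP [_ /eqP E].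
(* Each block of the pattern is the standardized trace on [S] of a block of [P]; [pick] then pulls
   the four labels back to elements. *)
have blkP (s : seq nat) : blk 4 s \in p14_23 -> exists2 B, B \in P &
    blk 4 s = [set i : 'I_4 | [exists x in B :&: S, rank_in S x == i]].
  rewrite -E => /imsetP [B' /setD1P [_ /imsetP [B PB ->]] ->]; by exists B.
have [B PB EB] : exists2 B, B \in P & blk 4 [:: 1; 4] =
  [set i : 'I_4 | [exists x in B :&: S, rank_in S x == i]] by apply: blkP; rewrite !inE eqxx.
have [C PC EC] : exists2 B, B \in P & blk 4 [:: 2; 3] =
  [set i : 'I_4 | [exists x in B :&: S, rank_in S x == i]] by apply: blkP; rewrite !inE eqxx orbT.
have pick (s : seq nat) D (i : 'I_4) :
    blk 4 s = [set i : 'I_4 | [exists x in D :&: S, rank_in S x == i]] ->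
    D \in P -> i.+1 \in s -> exists2 x, pblock P x = D & rank_in S x = i.
  move=> ED PD si; have : i \in blk 4 s by rewrite inE.
  rewrite ED inE => /existsP [x /andP [/setIP [Dx _] /eqP Ex]].
  by exists x; rewrite // (def_pblock tiP PD Dx).
have [a Ea ra] := pick _ _ (@Ordinal 4 0 isT) EB PB isT.
have [d Ed rd] := pick _ _ (@Ordinal 4 3 isT) EB PB isT.
have [b Eb rb] := pick _ _ (@Ordinal 4 1 isT) EC PC isT.
have [c Ec rc] := pick _ _ (@Ordinal 4 2 isT) EC PC isT.
exists a, b, c, d; split; split; try by apply: (@ltn_of_rank_in _ S); rewrite ?ra ?rb ?rc ?rd.
- by rewrite Ea.
- by rewrite Eb.
(* Equal blocks of [P] would have equal traces, but only the first block of the pattern contains the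
   label 1. *)
rewrite Ea Eb => EBC; have : blk 4 [:: 1; 4] = blk 4 [:: 2; 3] by rewrite EB EC EBC.
by move/setP/(_ (@Ordinal 4 0 isT)); rewrite !inE.
Qed.

Let contains_of_nesting (a b c d : 'I_n) : a < b -> b < c -> c < d ->
  pblock P a = pblock P d -> pblock P b = pblock P c -> pblock P a <> pblock P b ->
  contains P p14_23.
Proof.
move=> ab bc cd Ead Ebc Nab; apply/existsP; exists [set a; b; c; d].
set S := [set a; b; c; d].
have ne (x y : 'I_n) : x < y -> (x == y) = false by move=> xy; rewrite -val_eqE /=; lia.
have [ac bd] : a < c /\ b < d by split; lia.
have ad : a < d by lia.
have sumS (F : 'I_n -> nat) : \sum_(y in S) F y = F a + F b + F c + F d.
  rewrite (eq_bigl (mem [:: a; b; c; d])); last by move=> y; rewrite !inE -!orbA.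
  rewrite -big_uniq /=; last by rewrite !inE !ne.
  by rewrite !big_cons big_nil addn0 !addnA.
have cardS : #|S| = 4 by rewrite -sum1_card sumS.
have [ra rb rc rd] : [/\ rank_in S a = 0, rank_in S b = 1, rank_in S c = 2 & rank_in S d = 3].
  by rewrite !rank_inE !sumS; split; lia.
rewrite cardS eqxx /=; apply/eqP.
have mem_same x y : (y \in pblock P x) = (pblock P x == pblock P y) by rewrite eq_pblock.
have Nba : (pblock P b == pblock P a) = false by apply/eqP => /esym.
have Ba : pblock P a :&: S = [set a; d].
  apply/setP => x; rewrite !inE mem_same.
  case: (x =P a) => [->|_]; first by rewrite eqxx.
  case: (x =P b) => [->|_]; first by rewrite [pblock P a == _]eq_sym Nba (ne _ _ bd).
  case: (x =P c) => [->|_]; first by rewrite -Ebc [pblock P a == _]eq_sym Nba (ne _ _ cd).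
  by case: (x =P d) => [->|_]; rewrite ?andbF // Ead eqxx.
have Bb : pblock P b :&: S = [set b; c].
  apply/setP => x; rewrite !inE mem_same.
  case: (x =P b) => [->|_]; first by rewrite eqxx orbT.
  case: (x =P c) => [->|_]; first by rewrite Ebc eqxx orbT.
  case: (x =P a) => [->|_]; first by rewrite Nba.
  by case: (x =P d) => [->|_]; rewrite ?andbF // -Ead Nba.
(* A nonempty trace comes from a block meeting [S], hence from that of [a] or that of [b]. *)
have restrE : restrict P S = [set [set a; d]; [set b; c]].
  apply/setP => X; rewrite !inE; apply/andP/orP.
    move=> [nX /imsetP [B PB EX]]; have /set0Pn [x] := nX.
    rewrite EX => /setIP [xB xS]; rewrite -(def_pblock tiP PB xB).
    by move: xS; rewrite !inE -!orbA => /or4P [] /eqP ->; [left|right|right|left];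
      rewrite -?Ebc -?Ead ?Ba ?Bb.
  have im x : pblock P x :&: S \in [set B :&: S | B in P].
    by apply: imset_f; rewrite pblock_mem.
  case=> /eqP ->; split.
  - by apply/set0Pn; exists a; rewrite set21.
  - by rewrite -Ba im.
  - by apply/set0Pn; exists b; rewrite set21.
  - by rewrite -Bb im.
have imE (x y : 'I_n) (s : seq nat) :
    s = [:: (rank_in S x).+1; (rank_in S y).+1] ->
    [set i : 'I_4 | [exists z in [set x; y], rank_in S z == i]] = blk 4 s.
  move=> ->; apply/setP => i; rewrite !inE !eqSS; apply/existsP/orP.
    by case=> z /andP [/set2P [] -> /eqP ->]; [left|right].
  by case=> /eqP ->; [exists x|exists y]; rewrite !inE !eqxx ?orbT.
rewrite /standardize restrE imsetU1 imset_set1.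
by rewrite (imE a d [:: 1; 4]) ?(imE b c [:: 2; 3]) ?ra ?rb ?rc ?rd.
Qed.

Lemma avoids_14_23P : reflect (avoids_nesting (pblock P)) (~~ contains P p14_23).
Proof.
apply: (iffP idP) => [N a b c d ab bc cd Ead Ebc|H].
  by apply/eqP; apply: contraNT N => /eqP; exact: (contains_of_nesting ab bc cd).
apply/negP => /nesting_of_contains [a [b [c [d [[ab bc cd] [Ead Ebc]]]]]].
by apply; apply: (H a b c d).
Qed.

End Containment.

(** * The bijection between avoiders and words *)

Lemma class_letter_ext n (T T' : eqType) (k : 'I_n -> T) (k' : 'I_n -> T') :
  (forall i j, (k i == k j) = (k' i == k' j)) -> class_letter k =1 class_letter k'.
Proof.
by move=> kk i; congr (_, _); apply: eq_forallb => j; rewrite kk.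
Qed.

Lemma avoids_nesting_ext n (T T' : eqType) (k : 'I_n -> T) (k' : 'I_n -> T') :
  (forall i j, (k i == k j) = (k' i == k' j)) ->
  avoids_nesting k -> avoids_nesting k'.
Proof.
move=> kk av a b c d ab bc cd /eqP ad /eqP bc'; apply/eqP; rewrite -kk; apply/eqP.
by apply: (av a b c d) => //; apply/eqP; rewrite kk.
Qed.

Lemma pblock_preim n (T : eqType) (k : 'I_n -> T) i j :
  let P := preim_partition k [set: 'I_n] in
  (pblock P i == pblock P j) = (k i == k j).
Proof.
have partP := preim_partitionP k [set: 'I_n].
have [/eqP cP tiP _] := and3P partP; rewrite /= eq_pblock ?cP ?inE //.
rewrite pblock_equivalence_partition ?inE //.
by move=> x y z _ _ _; split=> // /eqP ->.
Qed.

Lemma eq_preim_partition n (T T' : eqType) (k : 'I_n -> T) (k' : 'I_n -> T') :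
  (forall i j, (k i == k j) = (k' i == k' j)) ->
  preim_partition k [set: 'I_n] = preim_partition k' [set: 'I_n].
Proof.
move=> kk; apply: eq_imset => i; apply/setP => j.
by rewrite !inE kk.
Qed.

Lemma mem_single_word_of n (P : {set {set 'I_n}}) : partition P [set: 'I_n] ->
  ((true, true) \notin word_of (pblock P)) = [forall B : {set 'I_n} in P, #|B| != 1].
Proof.
move=> partP; have [/eqP cP tiP _] := and3P partP.
apply/idP/forall_inP => [H B PB|H].
  apply: contra H => /cards1P [i EB].
  have Ei : pblock P i = [set i] by rewrite (def_pblock tiP PB) EB ?inE.
  apply/mapP; exists i; first by rewrite mem_enum.
  by congr (_, _); apply/esym/forallP => j; rewrite eq_sym eq_pblock ?cP ?inE // Ei inE;
    apply/implyP => /eqP ->.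
apply/mapP => -[i _ [/esym /forallP Hn /esym /forallP Hx]].
have /H /cards1P [] : pblock P i \in P by rewrite pblock_mem ?cP ?inE.
exists i; apply/setP => j; rewrite inE -eq_pblock ?cP ?inE // eq_sym.
apply/idP/eqP => [E|->//]; apply/val_inj/eqP.
by rewrite eqn_leq (implyP (Hx j) E) (implyP (Hn j) E).
Qed.

(** Taking words is a bijection whose inverse groups positions by label; [s] selects all avoiders or
    only those without singleton blocks. *)
Lemma card_avoiders n (s : bool) :
  #|[set P in avoiders n p14_23 | s || [forall B : {set 'I_n} in P, #|B| != 1]]|
    = size (paths s n 0).
Proof.
set A := [set P in _ | _].
have AP P : P \in A -> [/\ partition P [set: 'I_n], avoids_nesting (pblock P)
    & s || ((true, true) \notin word_of (pblock P))].
  rewrite !inE => /andP [/andP [partP nc] ns]; split=> //; first exact/avoids_14_23P.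
  by rewrite mem_single_word_of.
rewrite cardE -(size_map (fun P : {set {set 'I_n}} => word_of (pblock P))).
apply/perm_size/uniq_perm; last first.
- move=> w; apply/mapP/idP => [[P]|].
    rewrite mem_enum => /AP [partP av ns] ->.
    by rewrite mem_paths size_word_of eqxx ns valid_word_of.
  rewrite mem_paths => /and3P [/eqP w_size w_valid ns].
  pose P := preim_partition (fun i : 'I_n => label w i) [set: 'I_n].
  have PE i j : (pblock P i == pblock P j) = (label w i == label w j).
    exact: pblock_preim.
  have partP : partition P [set: 'I_n] by apply: preim_partitionP.
  have Ew : w = word_of (pblock P).
    apply: (@eq_from_nth _ (true, true)) => [|i]; rewrite ?size_word_of w_size // => lt.
    have -> : i = Ordinal lt by [].
    by rewrite nth_word_of (class_letter_ext PE) class_letter_label.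
  exists P => //; rewrite mem_enum !inE partP -mem_single_word_of // -Ew ns !andbT /=.
  apply/avoids_14_23P => //.
  by apply: (avoids_nesting_ext (k := fun i : 'I_n => label w i)) (label_avoids w_size w_valid).
- exact: paths_uniq.
rewrite map_inj_in_uniq ?enum_uniq // => P Q; rewrite !mem_enum.
move=> /AP [partP avP _] /AP [partQ avQ _] E.
(* The labels depend only on the word and determine the partition. *)
rewrite -(preim_partition_pblock partP) -(preim_partition_pblock partQ).
by apply: eq_preim_partition => i j; rewrite -!label_word_ofE // E.
Qed.

(** * Recurrences for the number of words *)

Lemma size_pathsS s n h : size (paths s n.+1 h) =
  size (paths s n h.+1) + (0 < h) * size (paths s n h.-1)
  + (h == 1) * size (paths s n h) + s * size (paths s n h).
Proof.
by case: s; case: h => [|[|h]]; rewrite /= ?size_cat ?size_map /= ?mul0n ?mul1n ?addn0 ?addnA.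
Qed.

(* Pascal's rule, as a singleton may be inserted at any step without changing
   the height. *)
Lemma size_paths_true n h :
  size (paths true n h) = \sum_(k < n.+1) 'C(n, k) * size (paths false k h).
Proof.
elim: n h => [|n IH] h; first by rewrite big_ord1 mul1n.
rewrite size_pathsS mul1n !IH.
have -> : \sum_(k < n.+2) 'C(n.+1, k) * size (paths false k h) =
    \sum_(k < n.+1) 'C(n, k) * size (paths false k.+1 h) +
    \sum_(k < n.+1) 'C(n, k) * size (paths false k h).
  have shift : 'C(n, 0) * size (paths false 0 h) +
      \sum_(k < n.+1) 'C(n, k.+1) * size (paths false k.+1 h) =
      \sum_(k < n.+1) 'C(n, k) * size (paths false k h).
    (* The sum is extended to [k = n.+1], where the binomial vanishes. *)
    transitivity (\sum_(k < n.+2) 'C(n, k) * size (paths false k h)).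
      by rewrite [RHS]big_ord_recl.
    by rewrite big_ord_recr /= bin_small // addn0.
  rewrite big_ord_recl; under eq_bigr do rewrite binS mulnDl.
  by rewrite big_split -shift !bin0 /= addnA [LHS]addnC.
congr (_ + _); rewrite !big_distrr -!big_split; apply: eq_bigr => k _ /=.
by rewrite size_pathsS mul0n addn0 !mulnDr !(mulnCA 'C(n, k)).
Qed.

(** * Power series: linear recurrences, composition, binomial columns *)

Local Open Scope ring_scope.

Section Series.
Variable F : fieldType.
Implicit Types f g u : fps F.

Lemma fps_coefXM f n : (fpsX F * f) n = if n is m.+1 then f m else 0.
Proof.
rewrite fps_coefM big_ord_recl mul0r add0r.
case: n => [|n]; first by rewrite big_ord0.
rewrite big_ord_recl mul1r subn1 big1 ?addr0 // => i _.
by rewrite mul0r.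
Qed.

Lemma fps_mulXI : injective (fun f => fpsX F * f).
Proof.
move=> f g E; apply: fpsP => n.
by have := congr1 (fun h : fps F => h n.+1) E; rewrite !fps_coefXM.
Qed.

Lemma fps_factorX f : f 0%N = 0 -> exists g, f = fpsX F * g.
Proof.
move=> f0; exists (FPS (fun n => f n.+1)); apply: fpsP => n.
by rewrite fps_coefXM; case: n.
Qed.

(** The factor [fpsX F] makes each coefficient depend on lower ones only, so induction on the degree
    works for all [h] at once. *)
Lemma fps_linear_rec_unique u (H : nat -> fps F) :
  (forall h, H h = fpsX F * (u * H h + H h.+1)) -> forall h, H h = 0.
Proof.
move=> HE; suff H0 n h m : (m < n)%N -> H h m = 0.
  by move=> h; apply: fpsP => n; rewrite fps_coef0 (H0 n.+1).
elim: n h m => // n IH h [|m]; rewrite ltnS HE fps_coefXM // => mn.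
rewrite fps_coefD fps_coefM IH // addr0 big1 // => i _.
by rewrite IH ?mulr0 // (leq_ltn_trans (leq_subr _ _)).
Qed.

(** As [g ^+ k] has no terms below degree [k], the sum defining each coefficient of the composition
    extends to all [k <= n], and the two sums can be exchanged. *)
Lemma fps_comp_mul f g h n : (forall k i, (i < k)%N -> (g ^+ k) i = 0) ->
  (fps_comp f g * h) n = \sum_(k < n.+1) f k * (g ^+ k * h) n.
Proof.
move=> g0; rewrite fps_coefM.
under [RHS]eq_bigr do rewrite fps_coefM big_distrr /=.
rewrite exchange_big /=; apply: eq_bigr => i _.
rewrite /= (big_ord_widen n.+1 (fun k => f k * (g ^+ k) i)) //.
rewrite big_distrl big_mkcond /=; apply: eq_bigr => k _.
by case: ltnP => [_|ik]; [rewrite mulrA | rewrite g0 // mul0r mulr0].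
Qed.

Definition fps_bin (k : nat) : fps F := FPS (fun n => 'C(n, k)%:R).

Let z := fpsX F.

Lemma fps_subX_unit : 1 - z \is a GRing.unit.
Proof. by rewrite fps_unitE fps_coefD fps_coefN fps_coef1 /= subr0 oner_eq0. Qed.

Lemma fps_bin0 : fps_bin 0 = 1 / (1 - z).
Proof.
apply: (canRL (mulrK fps_subX_unit)); rewrite mulrC mulrBl mul1r.
apply: fpsP => n; rewrite fps_coefD fps_coefN fps_coefXM fps_coef1 /=.
by case: n => [|n]; rewrite !bin0 ?subr0 ?subrr.
Qed.

(** Pascal's rule: passing from one column of the triangle to the next multiplies its series by
    [z / (1 - z)]. *)
Lemma fps_binE k : fps_bin k = (z / (1 - z)) ^+ k * (1 / (1 - z)).
Proof.
elim: k => [|k IH]; first by rewrite expr0 mul1r fps_bin0.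
rewrite exprS -mulrA -IH mulrAC; apply: (canRL (mulrK fps_subX_unit)).
rewrite mulrC mulrBl mul1r; apply: fpsP => n.
rewrite fps_coefD fps_coefN !fps_coefXM /=.
by case: n => [|n]; rewrite ?bin0n ?subr0 // binS natrD addrAC subrr add0r.
Qed.

Lemma fps_exp_geom_low k i : (i < k)%N -> ((z / (1 - z)) ^+ k) i = 0.
Proof.
move=> ik; have -> : (z / (1 - z)) ^+ k = (1 - z) * fps_bin k.
  by rewrite fps_binE mul1r [RHS]mulrC mulrVK ?fps_subX_unit.
rewrite mulrBl mul1r fps_coefD fps_coefN fps_coefXM /= bin_small //.
by case: i ik => [|i] ik; rewrite ?bin_small ?subr0 // ltnW.
Qed.

End Series.

(** * The functional equation and its solution *)

Definition path_series (h : nat) : fps rat := FPS (fun n => (size (paths false n h))%:R).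

(** The [1] accounts for the empty word; no singleton-free word has length 1. *)
Lemma path_series_nosingl : path_series 0 = gf_nosingl_14_23 + 1.
Proof.
apply: fpsP => -[|[|n]]; rewrite fps_coefD fps_coef1 ?add0r ?addr0 //=.
by rewrite -(card_avoiders n.+2 false).
Qed.

Lemma path_series_rec h : path_series h = (h == 0)%N%:R + fpsX rat *
  (path_series h.+1 + (0 < h)%N%:R * path_series h.-1 + (h == 1)%N%:R * path_series h).
Proof.
apply: fpsP => -[|n]; rewrite fps_coefD fps_coefXM.
  by case: h => [|h]; rewrite ?fps_coef0 ?fps_coef1 addr0.
have -> : ((h == 0)%N%:R : fps rat) n.+1 = 0.
  by case: h => [|h]; rewrite ?fps_coef0 ?fps_coef1.
have coefb (b : bool) (f : fps rat) : (b%:R * f) n = b%:R * f n.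
  by case: b; rewrite ?mul1r ?mul0r ?fps_coef0.
by rewrite add0r !fps_coefD !coefb /= size_pathsS mul0n addn0 !natrD !natrM.
Qed.

Lemma nosingl_functional_equation u : u = fpsX rat * (1 + u ^+ 2) ->
  gf_nosingl_14_23 * (1 - fpsX rat - fpsX rat ^+ 2 - fpsX rat * u) = fpsX rat ^+ 2.
Proof.
set z := fpsX rat => uE.
(* The difference of the two sides satisfies a homogeneous recurrence, whose only solution is 0. *)
have elevated h : path_series h.+2 = u * path_series h.+1.
  apply/subr0_eq/(@fps_linear_rec_unique _ u
    (fun h => path_series h.+2 - u * path_series h.+1)) => {}h.
  rewrite [X in X - _ = _]path_series_rec {1}uE /= -/z; ring.
have := path_series_rec 1; rewrite /= -/z path_series_nosingl elevated.
have := path_series_rec 0; rewrite /= -/z path_series_nosingl.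
set G := gf_nosingl_14_23; set F := path_series 1 => E0 E1.
(* Height 0 gives [G = z * F]; the equation at height 1, multiplied by [z], then yields the
   claim. *)
have -> : G = z * F by rewrite -[G](addrK 1) E0; ring.
transitivity (z * (F - (0 + z * (u * F + 1 * (1 + z * F) + 1 * F))) + z ^+ 2).
  by ring.
have <- : G + 1 = 1 + z * F by rewrite E0; ring.
by rewrite -E1 subrr mulr0 add0r.
Qed.

(** The series [u] is [(1 - R) / (2 z)] for the square root [R]; division by [z] is possible because
    [R] has constant term 1. *)
Lemma sqrt_functional_equation : exists u : fps rat,
  fps_sqrt (1 - 4 * fpsX rat ^+ 2) = 1 - 2 * fpsX rat * u /\
  u = fpsX rat * (1 + u ^+ 2).
Proof.
set z := fpsX rat; set R := fps_sqrt _.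
have [v Ev] : exists v, 1 - R = z * v.
  by apply: fps_factorX; rewrite fps_coefD fps_coefN fps_coef1 fps_sqrt_coef0 subrr.
have u2 : (2 : fps rat) \is a GRing.unit by rewrite fps_unitE.
have R2 : R ^+ 2 = 1 - 4 * z ^+ 2.
  apply: fps_sqr_sqrt => //.
  by rewrite fps_coefD fps_coefN mulrCA fps_coefXM fps_coef1 subr0.
pose u := 2^-1 * v; have vE : v = 2 * u by rewrite mulrA divrr // mul1r.
have RE : R = 1 - 2 * z * u by rewrite -[R](subKr 1) Ev vE; ring.
(* After multiplication by [4 z], the quadratic equation for [u] is [R ^+ 2 = 1 - 4 z ^+ 2]
   rewritten. *)
exists u; split=> //; apply: fps_mulXI; apply: (mulrI u2); apply: (mulrI u2).
transitivity (1 - (1 - 2 * z * u) ^+ 2 + 4 * z ^+ 2 * u ^+ 2); first by rewrite /= -/z; ring.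
by rewrite -RE R2 /= -/z; ring.
Qed.

Theorem theorem4p10 :
  let z : fps rat := fpsX rat in
  let G : fps rat := gf_nosingl_14_23 in
  gf_14_23 = fps_comp G (z / (1 - z)) * (1 / (1 - z)) + 1 / (1 - z)
  /\ G = (z - 2 * z ^+ 2 * (1 + z) - z * fps_sqrt (1 - 4 * z ^+ 2))
         / (- 2 + 2 * z * (1 + z) ^+ 2).
Proof.
move=> z G; split.
  apply: fpsP => n; rewrite fps_coefD fps_comp_mul; last exact: fps_exp_geom_low.
  transitivity ((size (paths true n 0))%:R : rat).
    by rewrite -card_avoiders; congr (_%:R); apply: eq_card => P; rewrite !inE andbT.
  rewrite size_paths_true natr_sum.
  (* The [G] part becomes the composition; the constant 1 survives only at [k = 0] and gives
     [1 / (1 - z)]. *)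
  transitivity (\sum_(k < n.+1) (G k * fps_bin rat k n + (val k == 0)%N%:R * fps_bin rat k n)).
    apply: eq_bigr => k _; rewrite natrM mulrC -mulrDl; congr (_ * _).
    by have /(congr1 (fun f : fps rat => f k)) := path_series_nosingl; rewrite fps_coefD fps_coef1.
  rewrite big_split; apply: congr2.
    by apply: eq_bigr => k _; rewrite fps_binE.
  rewrite big_ord_recl big1 => [|k _]; last by rewrite mul0r.
  by rewrite -fps_bin0 [LHS]addr0 mul1r.
have [u [sqrtE uE]] := sqrt_functional_equation; rewrite -/z in sqrtE; rewrite sqrtE.
have GE := nosingl_functional_equation uE.
have den_unit : - 2 + 2 * z * (1 + z) ^+ 2 \is a GRing.unit.
  by rewrite fps_unitE fps_coefD -mulrA mulrCA fps_coefXM addr0.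
apply: (canRL (mulrK den_unit)).
rewrite -/z -/G in uE GE.
(* Modulo [u = z (1 + u^2)], the product [(1 - z - z^2 - z u) (1 + z - u)] is [1 - z (1 + z)^2]; the
   last summand is the correction, which vanishes. *)
transitivity (- 2 * (G * (1 - z - z ^+ 2 - z * u)) * (1 + z - u)
   + 2 * G * (z * (1 + u ^+ 2) - u)); first by ring.
by rewrite GE -uE subrr; ring.
Qed.
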